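(* For every real number $x$ with $|x|<2$, $$\frac{\left(\arcsin(x/2)\right)^2}{\sqrt{4-x^2}}=\sum_{k=1}^\infty\frac{\binom{2k}{k}x^{2k}}{16^k}\left(H_{2k}^{(2)}-\frac14H_k^{(2)}\right).$$
   Context: For a positive integer $m$ and $n\in\{0,1,2,\ldots\}$, the harmonic numbers of order $m$ are $H_n^{(m)}=\sum_{0<k\le n}\frac{1}{k^m}$ (so $H_0^{(m)}=0$). *)

(* Defs.v *)
From Stdlib Require Import Reals.
From Coquelicot Require Import Coquelicot.
Open Scope R_scope.

(* [sum_n_m a 1 0 = 0], so [harmonic m 0 = 0]. *)
Definition harmonic (m n : nat) : R :=
  sum_n_m (fun k : nat => / INR k ^ m) 1 n.

(* Main.v *)
(* Put [y = x/2], [b_k = C(2k,k)/4^k] and [O_k = H_{2k}^(2) - H_k^(2)/4], the sum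
   of the inverse squares of the odd numbers below [2k]. Let [W], [P], [F] be the
   power series in [z] with coefficients [b_k], [b_k/(2k+1)] and [b_k O_k]. The
   recurrences of the coefficients say that
     [2(1-z)W' = W],  [P + 2zP' = W],  [2(1-z)F' - F = P].
   Hence on [(-1,1)] the functions [sqrt(1-y^2) W(y^2)], [y P(y^2) - asin y] and
   [sqrt(1-y^2) F(y^2) - (asin y)^2/2] successively have derivative zero. *)
Require Import Defs.
From Stdlib Require Import Reals Lra Lia.
From Coquelicot Require Import Coquelicot.
Open Scope R_scope.

(** * Analytic tools: vanishing derivatives, radii of convergence, differential equations *)

Lemma is_derive_zero_unit_interval (f : R -> R) (y : R) :
  (forall t, -1 < t < 1 -> is_derive f t 0) -> -1 < y < 1 -> f y = f 0.
Proof.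
  intros Hf Hy.
  destruct (Rtotal_order y 0) as [H | [-> | H]].
  - apply (eq_is_derive f y 0); [|exact H].
    intros t Ht; apply Hf; lra.
  - reflexivity.
  - symmetry; apply (eq_is_derive f 0 y); [|exact H].
    intros t Ht; apply Hf; lra.
Qed.

(** Dividing by [1 - r] turns the right side into [1 + r + ... + r ^ n], whose [n + 1] terms are
    each at least [r ^ n]. This bounds [(n + 1) * r ^ n] uniformly in [n]. *)
Lemma succ_mul_pow_le (r : R) (n : nat) :
  0 <= r <= 1 -> INR (S n) * r ^ n * (1 - r) <= 1 - r ^ S n.
Proof.
  intros Hr; induction n as [|n IH]; [simpl; lra|].
  assert (Hp : 0 <= r ^ S n <= 1).
  { split; [apply pow_le; lra|].
    rewrite <- (pow1 (S n)); apply pow_incr; lra. }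
  rewrite (S_INR (S n)).
  replace (r ^ S (S n)) with (r * r ^ S n) by reflexivity.
  replace ((INR (S n) + 1) * r ^ S n * (1 - r))
    with (r * (INR (S n) * r ^ n * (1 - r)) + r ^ S n * (1 - r)) by (simpl; ring).
  (* With the induction hypothesis, what remains is [0 <= (1 - r) * (1 - r ^ S n)]. *)
  nra.
Qed.

(** For [0 <= r < 1] the terms [a n * r ^ n] are bounded by [/ (1 - r)], so the radius is at least
    [r]. The crude linear bound fits all three coefficient sequences. *)
Lemma CV_radius_ge_1 (a : nat -> R) :
  (forall n, Rabs (a n) <= INR (S n)) -> Rbar_le 1 (CV_radius a).
Proof.
  intros Ha.
  destruct (CV_radius_bounded a) as [Hub _].
  assert (H : forall r, 0 <= r < 1 -> Rbar_le r (CV_radius a)).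
  { intros r Hr; apply Hub; exists (/ (1 - r)); intros n.
    rewrite Rabs_mult, <- RPow_abs, (Rabs_pos_eq r) by lra.
    assert (Hp : 0 <= r ^ n) by (apply pow_le; lra).
    assert (Hp' : 0 <= r ^ S n) by (apply pow_le; lra).
    apply Rle_trans with (INR (S n) * r ^ n).
    - apply Rmult_le_compat_r; [exact Hp | apply Ha].
    - apply Rmult_le_reg_r with (1 - r); [lra|].
      rewrite Rinv_l by lra.
      pose proof (succ_mul_pow_le r n) as Hs; lra. }
  pose proof (CV_radius_ge_0 a) as H0.
  destruct (CV_radius a) as [c| |]; simpl in *; try easy.
  destruct (Rle_lt_dec 1 c) as [Hc|Hc]; [exact Hc|].
  (* A radius [c < 1] would be exceeded by the midpoint of [c] and [1]. *)
  pose proof (H ((c + 1) / 2)); lra.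
Qed.

Lemma lt_CV_radius (a : nat -> R) (z : R) :
  (forall n, Rabs (a n) <= INR (S n)) -> Rabs z < 1 -> Rbar_lt (Rabs z) (CV_radius a).
Proof.
  intros Ha Hz.
  apply Rbar_lt_le_trans with (Finite 1); [exact Hz | now apply CV_radius_ge_1].
Qed.

(** In degree [n], the derived series has coefficient [(n + 1) * a (n + 1)], and [z] times it has
    [n * a n]. The recurrence thus compares coefficients in the differential equation. *)
Lemma PSeries_recurrence (a c : nat -> R) (alpha beta gamma z : R) :
  (forall n, alpha * (INR (S n) * a (S n)) + beta * (INR n * a n) + gamma * a n = c n) ->
  Rbar_lt (Rabs z) (CV_radius a) ->
  (alpha + beta * z) * PSeries (PS_derive a) z + gamma * PSeries a z = PSeries c z.
Proof.
  intros Hrec Hz.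
  assert (Ha := CV_radius_inside _ _ Hz).
  assert (Hd := ex_pseries_derive _ _ Hz).
  symmetry.
  rewrite (PSeries_ext c (PS_plus (PS_plus (PS_scal alpha (PS_derive a))
      (PS_scal beta (PS_incr_1 (PS_derive a)))) (PS_scal gamma a))).
  - rewrite !PSeries_plus, !PSeries_scal, PSeries_incr_1; [ring|..];
    repeat first [ apply ex_pseries_plus | apply ex_pseries_scal; [apply Rmult_comm|]
                 | apply (@ex_pseries_incr_1 R_AbsRing) | assumption ].
  - intros n; rewrite <- Hrec.
    unfold PS_plus, PS_scal, PS_incr_1, PS_derive, plus, scal, zero; simpl.
    (* At [n = 0] the shifted series has coefficient zero, which agrees with [INR 0 * a 0]. *)
    unfold mult; destruct n; simpl; ring.
Qed.

(** * The coefficient sequences, their recurrences and bounds *)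

Definition central_coef (n : nat) : R := Binomial.C (2 * n) n / 4 ^ n.

Lemma central_coef_0 : central_coef 0 = 1.
Proof. unfold central_coef, Binomial.C; simpl; lra. Qed.

Lemma central_coef_S (n : nat) :
  2 * INR (S n) * central_coef (S n) = (2 * INR n + 1) * central_coef n.
Proof.
  unfold central_coef, Binomial.C.
  replace (2 * S n - S n)%nat with (S n) by lia.
  replace (2 * n - n)%nat with n by lia.
  replace (2 * S n)%nat with (S (S (2 * n))) by lia.
  rewrite !fact_simpl, !mult_INR.
  assert (H2 : INR (2 * n) = 2 * INR n) by (rewrite mult_INR; reflexivity).
  rewrite !S_INR, H2.
  pose proof (pos_INR n); pose proof (INR_fact_neq_0 n).
  assert (4 ^ n <> 0) by (apply pow_nonzero; lra).
  simpl (4 ^ S n); field; repeat split; lra.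
Qed.

Lemma central_coef_bounds (n : nat) : 0 <= central_coef n <= 1.
Proof.
  induction n as [|n IH]; [rewrite central_coef_0; lra|].
  pose proof (central_coef_S n) as H; rewrite S_INR in H.
  pose proof (pos_INR n); split; nra.
Qed.

Definition arcsin_coef (n : nat) : R := central_coef n / (2 * INR n + 1).

Definition odd_harmonic2 (n : nat) : R := harmonic 2 (2 * n) - 1 / 4 * harmonic 2 n.

Lemma harmonic_S (m n : nat) : harmonic m (S n) = harmonic m n + / INR (S n) ^ m.
Proof. unfold harmonic; rewrite sum_n_Sm by lia; reflexivity. Qed.

Lemma odd_harmonic2_0 : odd_harmonic2 0 = 0.
Proof.
  unfold odd_harmonic2, harmonic; simpl.
  rewrite sum_n_m_zero by lia; unfold zero; simpl; ring.
Qed.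

(** The even term [/ (2 * n + 2) ^ 2] cancels against a quarter of [/ (n + 1) ^ 2]. *)
Lemma odd_harmonic2_S (n : nat) :
  odd_harmonic2 (S n) = odd_harmonic2 n + / (2 * INR n + 1) ^ 2.
Proof.
  unfold odd_harmonic2.
  replace (2 * S n)%nat with (S (S (2 * n))) by lia.
  rewrite !harmonic_S, !S_INR, mult_INR; change (INR 2) with 2.
  pose proof (pos_INR n); field; lra.
Qed.

Lemma odd_harmonic2_bounds (n : nat) : 0 <= odd_harmonic2 n <= INR n.
Proof.
  induction n as [|n IH]; [rewrite odd_harmonic2_0; simpl; lra|].
  rewrite odd_harmonic2_S, S_INR.
  pose proof (pos_INR n).
  assert (H1 : 1 <= (2 * INR n + 1) ^ 2) by nra.
  assert (0 < / (2 * INR n + 1) ^ 2) by (apply Rinv_0_lt_compat; lra).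
  assert (/ (2 * INR n + 1) ^ 2 <= / 1) by (apply Rinv_le_contravar; lra).
  lra.
Qed.

Definition arcsin_sq_coef (n : nat) : R := central_coef n * odd_harmonic2 n.

(** The inhomogeneous term is the factor [2 * n + 1] from [central_coef_S] times the increment
    [/ (2 * n + 1) ^ 2] of [odd_harmonic2]. *)
Lemma arcsin_sq_coef_S (n : nat) :
  2 * INR (S n) * arcsin_sq_coef (S n) = (2 * INR n + 1) * arcsin_sq_coef n + arcsin_coef n.
Proof.
  unfold arcsin_sq_coef, arcsin_coef.
  rewrite <- Rmult_assoc, central_coef_S, odd_harmonic2_S.
  pose proof (pos_INR n); field; lra.
Qed.

Lemma central_coef_abs (n : nat) : Rabs (central_coef n) <= INR (S n).
Proof.
  pose proof (central_coef_bounds n); pose proof (pos_INR n).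
  rewrite Rabs_pos_eq, S_INR; lra.
Qed.

Lemma arcsin_coef_abs (n : nat) : Rabs (arcsin_coef n) <= INR (S n).
Proof.
  pose proof (central_coef_bounds n); pose proof (pos_INR n).
  unfold arcsin_coef, Rdiv.
  assert (0 < / (2 * INR n + 1)) by (apply Rinv_0_lt_compat; lra).
  assert (/ (2 * INR n + 1) <= / 1) by (apply Rinv_le_contravar; lra).
  rewrite Rabs_pos_eq, S_INR; nra.
Qed.

Lemma arcsin_sq_coef_abs (n : nat) : Rabs (arcsin_sq_coef n) <= INR (S n).
Proof.
  pose proof (central_coef_bounds n); pose proof (odd_harmonic2_bounds n).
  unfold arcsin_sq_coef; rewrite Rabs_pos_eq, S_INR; nra.
Qed.

(** * Derivatives on the open unit interval *)

Lemma is_derive_PSeries_sq (a : nat -> R) (t : R) :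
  (forall n, Rabs (a n) <= INR (S n)) -> -1 < t < 1 ->
  is_derive (fun s => PSeries a (s ^ 2)) t (2 * t * PSeries (PS_derive a) (t ^ 2)).
Proof.
  intros Ha Ht.
  apply (is_derive_comp (PSeries a) (fun s => s ^ 2)).
  - apply is_derive_PSeries, lt_CV_radius; [exact Ha|].
    rewrite Rabs_pos_eq; nra.
  - auto_derive; [exact I | ring].
Qed.

Lemma sqrt_one_sub_sq (t : R) :
  -1 < t < 1 -> 0 < sqrt (1 - t ^ 2) /\ sqrt (1 - t ^ 2) ^ 2 = 1 - t ^ 2.
Proof.
  intros Ht; split; [apply sqrt_lt_R0; nra | apply pow2_sqrt; nra].
Qed.

Lemma is_derive_sqrt_one_sub_sq (t : R) :
  -1 < t < 1 -> is_derive (fun s => sqrt (1 - s ^ 2)) t (- t / sqrt (1 - t ^ 2)).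
Proof.
  intros Ht; destruct (sqrt_one_sub_sq t Ht) as [Hs _].
  evar_last.
  - apply (is_derive_sqrt (fun s => 1 - s ^ 2) t (- (2 * t))); [|nra].
    auto_derive; [exact I | ring].
  - simpl in *; field; lra.
Qed.

Lemma is_derive_asin (t : R) :
  -1 < t < 1 -> is_derive asin t (/ sqrt (1 - t ^ 2)).
Proof.
  intros Ht; apply is_derive_Reals.
  replace (/ sqrt (1 - t ^ 2)) with (derive_pt asin t (derivable_pt_asin t Ht)).
  - apply derive_pt_eq_1 with (derivable_pt_asin t Ht); reflexivity.
  - rewrite derive_pt_asin, <- Rsqr_pow2; unfold Rdiv; ring.
Qed.

(** * Closed forms of the three power series *)

Lemma PSeries_central_coef (y : R) :
  -1 < y < 1 -> PSeries central_coef (y ^ 2) = / sqrt (1 - y ^ 2).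
Proof.
  intros Hy; destruct (sqrt_one_sub_sq y Hy) as [Hs _].
  assert (H : sqrt (1 - y ^ 2) * PSeries central_coef (y ^ 2) = 1).
  { rewrite (is_derive_zero_unit_interval
      (fun t => sqrt (1 - t ^ 2) * PSeries central_coef (t ^ 2))); [| |exact Hy].
    - replace (0 ^ 2) with 0 by ring.
      rewrite PSeries_0, central_coef_0, Rminus_0_r, sqrt_1; ring.
    - intros t Ht; destruct (sqrt_one_sub_sq t Ht) as [Hts Hts2].
      evar_last.
      + apply Derive.is_derive_mult; [now apply is_derive_sqrt_one_sub_sq|].
        apply is_derive_PSeries_sq; [exact central_coef_abs | exact Ht].
      + assert (Hode : (2 + -2 * t ^ 2) * PSeries (PS_derive central_coef) (t ^ 2)
            + -1 * PSeries central_coef (t ^ 2) = PSeries (fun _ => 0) (t ^ 2)).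
        { apply PSeries_recurrence.
          - intros n; pose proof (central_coef_S n); lra.
          - apply lt_CV_radius; [exact central_coef_abs | rewrite Rabs_pos_eq; nra]. }
        rewrite PSeries_const_0 in Hode.
        (* Multiplying by the root leaves [t * (2 * (1 - t ^ 2) * W' - W)], which vanishes by
           [Hode]. *)
        apply Rmult_eq_reg_r with (sqrt (1 - t ^ 2)); [|lra].
        field_simplify; [|lra].
        rewrite Hts2.
        replace (PSeries central_coef (t ^ 2))
          with ((2 + -2 * t ^ 2) * PSeries (PS_derive central_coef) (t ^ 2)) by lra.
        ring. }
  apply Rmult_eq_reg_l with (sqrt (1 - y ^ 2)); [|lra].
  rewrite H; field; lra.
Qed.

(** The derivative of [t * P(t ^ 2)] is [P + 2 * t ^ 2 * P'], which equals [W(t ^ 2)], the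
    derivative of [asin]. *)
Lemma PSeries_arcsin_coef (y : R) :
  -1 < y < 1 -> y * PSeries arcsin_coef (y ^ 2) = asin y.
Proof.
  intros Hy.
  enough (H : y * PSeries arcsin_coef (y ^ 2) - asin y = 0) by lra.
  rewrite (is_derive_zero_unit_interval
    (fun t => t * PSeries arcsin_coef (t ^ 2) - asin t)); [| |exact Hy].
  - rewrite asin_0; ring.
  - intros t Ht.
    evar_last.
    + apply (is_derive_minus (fun t => t * PSeries arcsin_coef (t ^ 2)) asin).
      * apply Derive.is_derive_mult; [apply is_derive_id|].
        apply is_derive_PSeries_sq; [exact arcsin_coef_abs | exact Ht].
      * now apply is_derive_asin.
    + assert (Hode : (0 + 2 * t ^ 2) * PSeries (PS_derive arcsin_coef) (t ^ 2)
          + 1 * PSeries arcsin_coef (t ^ 2) = PSeries central_coef (t ^ 2)).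
      { apply PSeries_recurrence.
        - intros n; pose proof (pos_INR n).
          rewrite Rmult_0_l; unfold arcsin_coef; field; lra.
        - apply lt_CV_radius; [exact arcsin_coef_abs | rewrite Rabs_pos_eq; nra]. }
      rewrite PSeries_central_coef in Hode by exact Ht.
      rewrite <- Hode; unfold minus, plus, opp, one; simpl; ring.
Qed.

(** With [s = sqrt (1 - t ^ 2)], the derivative of [s * F(t ^ 2)] is
    [t / s * (2 * (1 - t ^ 2) * F' - F)]. This is [t * P(t ^ 2) / s = asin t / s], the derivative of
    [asin t ^ 2 / 2]. *)
Lemma PSeries_arcsin_sq_coef (y : R) :
  -1 < y < 1 -> PSeries arcsin_sq_coef (y ^ 2) = asin y ^ 2 / (2 * sqrt (1 - y ^ 2)).
Proof.
  intros Hy; destruct (sqrt_one_sub_sq y Hy) as [Hs _].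
  assert (H : sqrt (1 - y ^ 2) * PSeries arcsin_sq_coef (y ^ 2) - asin y ^ 2 / 2 = 0).
  { rewrite (is_derive_zero_unit_interval
      (fun t => sqrt (1 - t ^ 2) * PSeries arcsin_sq_coef (t ^ 2) - asin t ^ 2 / 2));
      [| |exact Hy].
    - replace (0 ^ 2) with 0 by ring.
      rewrite PSeries_0, asin_0; unfold arcsin_sq_coef; rewrite odd_harmonic2_0; field.
    - intros t Ht; destruct (sqrt_one_sub_sq t Ht) as [Hts Hts2].
      evar_last.
      + apply (is_derive_minus (fun t => sqrt (1 - t ^ 2) * PSeries arcsin_sq_coef (t ^ 2))
          (fun t => asin t ^ 2 / 2)).
        * apply Derive.is_derive_mult; [now apply is_derive_sqrt_one_sub_sq|].
          apply is_derive_PSeries_sq; [exact arcsin_sq_coef_abs | exact Ht].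
        * apply (is_derive_ext (fun t => / 2 * asin t ^ 2));
            [intros; unfold Rdiv; apply Rmult_comm|].
          apply is_derive_scal, is_derive_pow, is_derive_asin, Ht.
      + assert (Hode : (2 + -2 * t ^ 2) * PSeries (PS_derive arcsin_sq_coef) (t ^ 2)
            + -1 * PSeries arcsin_sq_coef (t ^ 2) = PSeries arcsin_coef (t ^ 2)).
        { apply PSeries_recurrence.
          - intros n; pose proof (arcsin_sq_coef_S n); lra.
          - apply lt_CV_radius; [exact arcsin_sq_coef_abs | rewrite Rabs_pos_eq; nra]. }
        (* Both rewrites express [asin t] through [F] and [F'], leaving an algebraic identity that
           follows from [s ^ 2 = 1 - t ^ 2]. *)
        rewrite <- (PSeries_arcsin_coef t Ht), <- Hode.
        revert Hts Hts2; generalize (sqrt (1 - t ^ 2)); intros s Hts Hts2.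
        unfold minus, plus, opp; simpl.
        apply Rmult_eq_reg_r with s; [|lra].
        field_simplify; [|lra].
        rewrite Hts2; simpl; field. }
  apply Rmult_eq_reg_l with (sqrt (1 - y ^ 2)); [|lra].
  transitivity (asin y ^ 2 / 2); [lra | field; lra].
Qed.

(* The sum runs over k >= 1, reindexed as k = S n. *)
Theorem theorem1p1 (x : R) (hx : Rabs x < 2) :
  is_series
    (fun n : nat =>
       let k := S n in
       Binomial.C (2 * k) k * x ^ (2 * k) / 16 ^ k *
       (harmonic 2 (2 * k) - 1 / 4 * harmonic 2 k))
    ((asin (x / 2)) ^ 2 / sqrt (4 - x ^ 2)).
Proof.
  apply Rabs_def2 in hx.
  assert (Hy : -1 < x / 2 < 1) by lra.
  assert (Hsqrt : sqrt (4 - x ^ 2) = 2 * sqrt (1 - (x / 2) ^ 2)).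
  { replace (4 - x ^ 2) with (2 ^ 2 * (1 - (x / 2) ^ 2)) by field.
    rewrite sqrt_mult, sqrt_pow2; nra. }
  rewrite Hsqrt, <- PSeries_arcsin_sq_coef by exact Hy.
  apply (is_series_ext (fun n => arcsin_sq_coef (S n) * ((x / 2) ^ 2) ^ S n)).
  - intros n; cbv zeta; set (k := S n).
    unfold arcsin_sq_coef, central_coef; fold (odd_harmonic2 k).
    rewrite <- !pow_mult; unfold Rdiv; rewrite Rpow_mult_distr, pow_inv.
    (* In [16 ^ k], one factor [4 ^ k] comes from [(x / 2) ^ (2 * k)] and the other from
       [central_coef k]. *)
    replace 16 with (2 ^ 2 * 4) by ring.
    rewrite Rpow_mult_distr, <- pow_mult.
    (* The equation is typed in a Coquelicot structure; [field] needs it over [R]. *)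
    match goal with |- ?l = ?r => change (@eq R l r) end.
    field; split; apply pow_nonzero; lra.
  (* The term of index zero may be restored, since [odd_harmonic2 0 = 0] makes it vanish. *)
  - apply (is_series_incr_1 (fun n => arcsin_sq_coef n * ((x / 2) ^ 2) ^ n)).
    replace (plus _ _) with (PSeries arcsin_sq_coef ((x / 2) ^ 2)).
    + apply is_pseries_R, PSeries_correct, CV_radius_inside, lt_CV_radius;
        [exact arcsin_sq_coef_abs | rewrite Rabs_pos_eq; nra].
    + unfold plus, arcsin_sq_coef; rewrite odd_harmonic2_0; simpl; ring.
Qed.
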